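(* Let $X$ and $Y$ be locally compact Polish spaces, let $\mu\in\mathcal{P}(X)$ and $\nu\in\mathcal{P}(Y)$ be Borel probability measures, and let $c:X\times Y\to[0,\infty]$ be Borel-measurable and finite $\mu\otimes\nu$-almost everywhere. If $\pi\in\Pi(\mu,\nu)$ is $c$-cyclically monotone and $\mathcal{C}(\pi)<\infty$, then $\pi$ is optimal for the optimal transport problem, i.e. $\mathcal{C}(\pi)\le\mathcal{C}(\gamma)$ for all $\gamma\in\Pi(\mu,\nu)$.
   Context: $\Pi(\mu,\nu)$ is the set of transport plans, i.e. Borel probability measures on $X\times Y$ with first marginal $\mu$ and second marginal $\nu$. The transport cost is $\mathcal{C}(\pi):=\int_{X\times Y}c(x,y)\,\pi(dx,dy)$, and the optimal transport problem is $\min_{\pi\in\Pi(\mu,\nu)}\mathcal{C}(\pi)$. A set $\Gamma\subset X\times Y$ is $c$-cyclically monotone if for every $n\in\mathbb{N}$ and all $(x_1,y_1),\dots,(x_n,y_n)\in\Gamma$ one has $\sum_{i=1}^n c(x_i,y_i)\le\sum_{i=1}^n c(x_i,y_{i+1})$, where $y_{n+1}:=y_1$. A plan $\pi\in\Pi(\mu,\nu)$ is $c$-cyclically monotone if there is a (measurable) $c$-cyclically monotone set $\Gamma\subset X\times Y$ with $\pi(\Gamma)=1$. *)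

(* Defs.v *)
From HB Require Import structures.
From mathcomp Require Import all_boot all_order all_algebra.
From mathcomp Require Import all_classical all_reals all_analysis.
From mathcomp Require Import measurable_realfun.

Set Implicit Arguments.
Unset Strict Implicit.
Unset Printing Implicit Defensive.

Import Order.TTheory GRing.Theory Num.Theory.

Local Open Scope classical_set_scope.
Local Open Scope ring_scope.
Local Open Scope ereal_scope.

Definition is_metric (R : realType) (T : Type) (d : T -> T -> R) : Prop :=
  [/\ forall x y, (0 <= d x y)%R,
      forall x y, (d x y = 0)%R <-> x = y,
      forall x y, d x y = d y x &
      forall x y z, (d x z <= d x y + d y z)%R].

Definition metric_induces_topology (R : realType) (T : topologicalType)
    (d : T -> T -> R) : Prop :=
  forall (x : T) (A : set T),
    nbhs x A <-> exists2 e : R, (0 < e)%R & [set y | (d x y < e)%R] `<=` A.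

Definition metric_complete (R : realType) (T : Type) (d : T -> T -> R) : Prop :=
  forall u : nat -> T,
    (forall e : R, (0 < e)%R -> exists N : nat,
       forall m n : nat, (N <= m)%N -> (N <= n)%N -> (d (u m) (u n) < e)%R) ->
    exists x : T, forall e : R, (0 < e)%R -> exists N : nat,
       forall n : nat, (N <= n)%N -> (d x (u n) < e)%R.

Definition completely_metrizable (R : realType) (T : topologicalType) : Prop :=
  exists d : T -> T -> R,
    [/\ is_metric d, metric_induces_topology d & metric_complete d].

Definition separable (T : topologicalType) : Prop :=
  exists2 D : set T, countable D & dense D.

(* Being Polish only depends on the topology; the real type R is where the
   witnessing distance takes its values. *)
Definition polish (R : realType) (T : topologicalType) : Prop :=
  separable T /\ completely_metrizable R T.

(* A notation rather than a definition, so that the measurable structure of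
   g_sigma_algebraType is inferred. On a product, borel (X * Y) is generated by
   the open sets of the product topology, whereas borel X * borel Y carries the
   product sigma-algebra; mu \x nu lives on the latter. *)
Notation borel T := (g_sigma_algebraType (@open T)).

Section optimal_transport.
Context {R : realType} {X Y : ptopologicalType}.
Implicit Types (c : X * Y -> \bar R).
Implicit Types (mu : probability (borel X) R) (nu : probability (borel Y) R).
Implicit Types (pi : probability (borel (X * Y)%type) R).

Definition transport_plans mu nu : set (probability (borel (X * Y)%type) R) :=
  [set pi | (forall A : set (borel X), measurable A ->
               pi (fst @^-1` A) = mu A) /\
            (forall B : set (borel Y), measurable B ->
               pi (snd @^-1` B) = nu B)].

Definition transport_cost c pi : \bar R := \int[pi]_z c z.

Definition optimal_plan c mu nu pi : Prop :=
  transport_plans mu nu pi /\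
  forall gamma, transport_plans mu nu gamma ->
    transport_cost c pi <= transport_cost c gamma.

(* ordS i is the cyclic successor i + 1 mod n. *)
Definition cyclically_monotone_set c (Gamma : set (X * Y)) : Prop :=
  forall (n : nat) (z : 'I_n -> X * Y), (forall i, Gamma (z i)) ->
    \sum_(i < n) c (z i) <= \sum_(i < n) c ((z i).1, (z (ordS i)).2).

Definition cyclically_monotone_plan c pi : Prop :=
  exists Gamma : set (borel (X * Y)%type),
    [/\ measurable Gamma, cyclically_monotone_set c Gamma & pi Gamma = 1].

End optimal_transport.

(* Main.v *)
From HB Require Import structures.
Require Import Defs.
From mathcomp Require Import all_boot all_order all_algebra.
From mathcomp Require Import all_classical all_reals all_analysis.
From mathcomp Require Import measurable_realfun lra.

(* Idea. Given pi and another plan gamma, build a chain of random points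
   x_0, y_0, x_1, y_1, ..., x_n, y_n with (x_i, y_i) ~ pi and
   (x_i, y_(i+1)) ~ gamma, and an independent copy x'_i, y'_i of it. Closing the
   two chains into one cycle, cyclical monotonicity gives almost surely
     sum_(i <= n) c(x_i, y_i) + sum_(i <= n) c(x'_i, y'_i)
     <= sum_(i < n) c(x_i, y_(i+1)) + sum_(i < n) c(x'_i, y'_(i+1))
        + c(x_n, y'_0) + c(x'_n, y_0).
   The two closing pairs have law mu \x nu for every n. With N = n + 1 and c
   replaced by min(c, M) on the left, the closing costs may be truncated at 2NM;
   taking expectations and dividing by 2N,
     int min(c, M) dpi <= int c dgamma + int min(c / N, 2M) d(mu \x nu).
   The last integral tends to 0 by dominated convergence, c being finite
   mu \x nu-almost everywhere; then let M tend to infinity.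

   The chain needs disintegrations. A Polish space is a measurable retract of
   the extended reals, so the conditional laws can be sampled by quantile
   functions of conditional cumulative distribution functions, which are
   Radon-Nikodym derivatives. *)

Set Implicit Arguments.
Unset Strict Implicit.
Unset Printing Implicit Defensive.

Import Order.TTheory GRing.Theory Num.Theory.
Import numFieldNormedType.Exports.

Local Open Scope classical_set_scope.
Local Open Scope ring_scope.
Local Open Scope ereal_scope.

(** * Laws of measurable maps *)

Section law.
Context d (T : measurableType d) d1 (T1 : measurableType d1)
  d2 (T2 : measurableType d2) (R : realType).

(** [P] and [Q] are bare set functions, so that probabilities and product measures alike fit through
    their coercions. *)
Definition has_law (P : set T -> \bar R) (f : T -> T1) (Q : set T1 -> \bar R) :=
  measurable_fun setT f /\ forall A, measurable A -> P (f @^-1` A) = Q A.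

Lemma has_law_integral (P : {measure set T -> \bar R}) (f : T -> T1)
    (Q : {measure set T1 -> \bar R}) (g : T1 -> \bar R) :
  has_law P f Q -> measurable_fun setT g -> (forall y, 0 <= g y) ->
  \int[P]_x g (f x) = \int[Q]_y g y.
Proof.
move=> [mf PQ] mg g0.
transitivity (\int[pushforward P f]_y g y).
  by rewrite ge0_integral_pushforward//= ?preimage_setT// => y _; exact: g0.
by apply: eq_measure_integral => A mA _; exact: PQ.
Qed.

Lemma has_law_ex (P : probability T R) (f : T -> T1) :
  measurable_fun setT f -> exists Q : probability T1 R, has_law P f Q.
Proof.
move=> mf; pose F : {mfun T >-> T1} :=
  HB.pack f (isMeasurableFun.Build _ _ _ _ f mf).
by exists (distribution P F).
Qed.

(** Measurable rectangles are stable under intersection and generate the product sigma-algebra, and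
    the whole space is itself a rectangle, of finite mass. *)
Lemma eq_measure_prod (m1 m2 : {measure set (T1 * T2) -> \bar R}) :
  m1 setT < +oo ->
  (forall A B, measurable A -> measurable B -> m1 (A `*` B) = m2 (A `*` B)) ->
  forall C, measurable C -> m1 C = m2 C.
Proof.
move=> m1oo m12 C mC.
apply: (measure_unique [set A `*` B | A in measurable & B in measurable]
  (fun=> setT)) => //.
- exact: measurable_prod_measurableType.
- move=> _ _ [A mA [B mB <-]] [A' mA' [B' mB' <-]].
  exists (A `&` A'); first exact: measurableI.
  exists (B `&` B'); first exact: measurableI.
  by apply/seteqP; split => [[x y] [[? ?] [? ?]]|[x y] [[? ?] [? ?]]].
- by move=> _; exists setT => //; exists setT => //; rewrite setXTT.
- exact: bigcup_const.
- by move=> _ [A mA [B mB <-]]; exact: m12.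
Qed.

End law.

Lemma has_law_comp d (T : measurableType d) d1 (T1 : measurableType d1)
    d2 (T2 : measurableType d2) (R : realType) (P : set T -> \bar R)
    (Q : set T1 -> \bar R) (S : set T2 -> \bar R) (f : T -> T1) (g : T1 -> T2) :
  has_law P f Q -> has_law Q g S -> has_law P (g \o f) S.
Proof.
move=> [mf PQ] [mg QS]; split; first exact: measurableT_comp.
by move=> A mA; rewrite comp_preimage PQ ?QS// -[_ @^-1` _]setTI; exact: mg.
Qed.

Lemma has_law_prod d (T : measurableType d) d' (T' : measurableType d')
    d1 (T1 : measurableType d1) d2 (T2 : measurableType d2) (R : realType)
    (P : probability T R) (P' : probability T' R)
    (Q : probability T1 R) (Q' : probability T2 R) (f : T -> T1) (g : T' -> T2) :
  has_law P f Q -> has_law P' g Q' ->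
  has_law (P \x P') (fun w => (f w.1, g w.2)) (Q \x Q').
Proof.
move=> [mf PQ] [mg PQ'].
have mfg : measurable_fun setT (fun w : T * T' => (f w.1, g w.2)).
  by apply: measurable_fun_pair; exact: measurableT_comp.
(* The image is named as a probability [S], so that uniqueness of measures on rectangles applies to
   it. *)
have [S [_ SE]] := has_law_ex (P \x P') mfg.
split=> // C mC; rewrite SE//.
apply: eq_measure_prod => // [|A B mA mB]; first by
  rewrite [ltLHS](probability_setT S) ltry.
have mfA : measurable (f @^-1` A) by rewrite -[_ @^-1` _]setTI; exact: mf.
have mgB : measurable (g @^-1` B) by rewrite -[_ @^-1` _]setTI; exact: mg.
transitivity ((P \x P') ((f @^-1` A) `*` (g @^-1` B))).
  by apply/esym/SE; exact: measurableX.
transitivity (Q A * Q' B); last exact/esym/product_measure1E.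
by rewrite -(PQ _ mA) -(PQ' _ mB); exact: product_measure1E.
Qed.

Lemma has_law_fst d1 (T1 : measurableType d1) d2 (T2 : measurableType d2)
    (R : realType) (P : probability T1 R) (Q : probability T2 R) :
  has_law (P \x Q) fst P.
Proof.
split=> // A mA; rewrite (_ : fst @^-1` A = A `*` setT); last first.
  by apply/seteqP; split => [[x y]|[x y] []].
by rewrite product_measure1E// [X in _ * X](probability_setT Q) mule1.
Qed.

Lemma has_law_snd d1 (T1 : measurableType d1) d2 (T2 : measurableType d2)
    (R : realType) (P : probability T1 R) (Q : probability T2 R) :
  has_law (P \x Q) snd Q.
Proof.
split=> // A mA; rewrite (_ : snd @^-1` A = setT `*` A); last first.
  by apply/seteqP; split => [[x y]|[x y] []].
by rewrite product_measure1E// [X in X * _](probability_setT P) mul1e.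
Qed.

(** The rational rays and the whole space form a generating family closed under intersection. Total
    masses are compared separately because no ray contains [+oo]. *)
Lemma eq_measure_ereal (R : realType) (m1 m2 : {measure set \bar R -> \bar R}) :
  m1 setT < +oo -> m1 setT = m2 setT ->
  (forall q : rat, m1 [set y | y < (ratr q : R)%:E] =
                   m2 [set y | y < (ratr q : R)%:E]) ->
  forall A, measurable A -> m1 A = m2 A.
Proof.
move=> m1oo m12T m12 A mA.
pose ray (q : rat) : set (\bar R) := [set y | y < (ratr q : R)%:E].
apply: (measure_unique ([set setT] `|` range ray) (fun=> setT)) => //.
- rewrite -[LHS]/(emeasurable (@ocitv R)) ErealGenInftyO.measurableE.
  apply/seteqP; split; apply: smallest_sub => //.
  + move=> _ [r ->]; rewrite (_ : [set` _] =
        \bigcup_q (if (ratr q <= r)%R then ray q else set0)); last first.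
      apply/seteqP; split => [y /=|y [q _]]; rewrite /= in_itv/=; last first.
        by case: ifPn => // qr /lt_le_trans; apply; rewrite lee_fin.
      move=> yr; have [q yq qr] : exists2 q : rat,
          y < (ratr q : R)%:E & (ratr q <= r)%R.
        case: y yr => [y| |] yr //.
          rewrite lte_fin in yr; have [q] := rat_in_itvoo yr.
          rewrite in_itv/= => /andP[yq qr].
          by exists q; rewrite ?lte_fin// ltW.
        have r1r : (r - 1 < r)%R by rewrite ltrBlDr ltrDl.
        have [q] := rat_in_itvoo r1r; rewrite in_itv/= => /andP[_ /ltW qr].
        by exists q => //; exact: ltNyr.
      by exists q => //; rewrite qr.
    apply: (@bigcupT_measurable_rat _
      (g_sigma_algebraType ([set setT] `|` range ray))) => q; case: ifP => // _.
    by apply: sub_sigma_algebra; right; exists q.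
  + exact: smallest_sigma_algebra.
  + move=> _ [->|[q _ <-]].
      exact: (@measurableT _ (g_sigma_algebraType (@ErealGenInftyO.G R))).
    apply: sub_sigma_algebra; exists (ratr q).
    by apply/seteqP; split => y /=; rewrite in_itv.
- move=> _ _ [->|[p _ <-]] [->|[q _ <-]]; rewrite ?setTI ?setIT.
  + by left.
  + by right; exists q.
  + by right; exists p.
  + right; exists (Order.min p q) => //; apply/seteqP; split => y /=.
      rewrite /ray/= minEle; case: ifPn => [pq|]; last rewrite -ltNge => /ltW pq.
        by move=> yp; split=> //; apply: lt_le_trans yp _; rewrite lee_fin ler_rat.
      by move=> yp; split=> //; apply: lt_le_trans yp _; rewrite lee_fin ler_rat.
    by rewrite /ray/= minEle; case: ifP => _ [].
- by left.
- exact: bigcup_const.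
- by move=> _ [->//|[q _ <-]]; exact: m12.
Qed.

Lemma has_law_swap d (T : measurableType d) d' (T' : measurableType d')
    (R : realType) (P : probability T R) (P' : probability T' R) :
  has_law (P \x P') (fun w => (w.2, w.1)) (P' \x P).
Proof.
have msw : measurable_fun setT (fun w : T * T' => (w.2, w.1)).
  exact: measurable_fun_pair.
have [S [_ SE]] := has_law_ex (P \x P') msw.
split=> // C mC; rewrite SE//.
apply: eq_measure_prod => // [|A B mA mB].
  by rewrite [ltLHS](probability_setT S) ltry.
transitivity ((P \x P') (B `*` A)).
  rewrite -[LHS]SE; last exact: measurableX.
  by congr ((_ \x _) _); apply/seteqP; split => [[? ?] []|[? ?] []].
rewrite [LHS]product_measure1E// muleC.
exact/esym/product_measure1E.
Qed.

(** * Disintegration by quantile functions *)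

Section disintegration.
Context d (T : measurableType d) (R : realType).
Variables (mu : probability T R).
Variable (d' : measure_display) (U : measurableType d').
Variable (m : probability (T * U)%type R).
Hypothesis m_mu : forall A, measurable A -> m (A `*` setT) = mu A.

(** Restricting the second coordinate to [B] and projecting [m] gives a finite measure dominated by
    [mu]; the density is its Radon-Nikodym derivative. *)
Lemma section_density (B : set U) : measurable B ->
  exists f : T -> \bar R, [/\ forall x, 0 <= f x,
    mu.-integrable setT f &
    forall A, measurable A -> m (A `*` B) = \int[mu]_(x in A) f x].
Proof.
move=> mB.
have mTB : measurable ([set: T] `*` B) by exact: measurableX.
have mf : measurable_fun [set: T * U] fst by exact: measurable_fst.
pose n0_ : {measure set T -> \bar R} :=
  pushforward (mrestr m mTB) fst.
pose n0 := n0_ mf.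
have n0E A : measurable A -> n0 A = m (A `*` B).
  move=> mA; rewrite /n0/= /pushforward /mrestr; congr (m _).
  by apply/seteqP; split => [[x y]/= [? []]//|[x y]/= []//].
have n0fin : fin_num_fun n0.
  move=> A mA; rewrite n0E//; apply: fin_num_measure => //; exact: measurableX.
pose n0i := Measure_isFinite.Build _ _ _ (Measure.sort n0) n0fin.
pose n1 := HB.pack_for (FiniteMeasure.type T R) (Measure.sort n0) n0i.
have n1mu : n1 `<< mu.
  apply/null_content_dominatesP => A mA muA.
  rewrite [LHS]n0E//; apply/eqP; rewrite eq_le measure_ge0 andbT.
  apply: (@le_trans _ _ (m (A `*` setT))); last by rewrite m_mu// muA.
  by apply: le_measure => //; rewrite ?inE; [exact: measurableX..|move=> [x y] []].
have [f [f0 fi fE]] := radon_nikodym_finite n1mu.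
by exists f; split => // A mA; rewrite -n0E// -fE.
Qed.


(** A version of the conditional probability of [B] given the first coordinate. *)
Definition is_section_density (B : set U) (f : T -> \bar R) :=
  [/\ forall x, 0 <= f x, mu.-integrable setT f &
    forall A, measurable A -> m (A `*` B) = \int[mu]_(x in A) f x].

(** Densities are additive in the set and almost everywhere unique, so [f'] is [f] plus a
    nonnegative density [g] of the difference of the two sets. *)
Lemma section_density_le (B B' : set U) (f f' : T -> \bar R) :
  measurable B -> measurable B' -> B `<=` B' ->
  is_section_density B f -> is_section_density B' f' ->
  \forall x \ae mu, f x <= f' x.
Proof.
move=> mB mB' BB' [f0 fi fE] [f'0 f'i f'E].
have mB'B : measurable (B' `\` B) by exact: measurableD.
have [g [g0 gi gE]] := section_density mB'B.
have mf : measurable_fun setT f := measurable_int _ fi.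
have mg : measurable_fun setT g := measurable_int _ gi.
have : ae_eq mu setT f' (f \+ g).
  apply: integral_ae_eq => //; first exact: emeasurable_funD.
  move=> E _ mE; rewrite ge0_integralD//; [|exact: measurable_funTS..].
  rewrite -f'E// -fE// -gE// -measureU; [|exact: measurableX..|].
    congr (m _); apply/seteqP; split => [[x y] [Ex B'y]|[x y] []].
    - by have [By|nBy] := pselect (B y); [left|right].
    - by move=> [Ex /BB' B'y].
    - by move=> [Ex []].
  by apply/seteqP; split => // -[x y] [[_ By] [_ [_ /(_ By)]]].
by apply: filterS => x /(_ Logic.I) ->; rewrite leeDl.
Qed.

Lemma section_density_le1 (B : set U) (f : T -> \bar R) : measurable B ->
  is_section_density B f -> \forall x \ae mu, f x <= 1.
Proof.
move=> mB fB.
apply: (section_density_le (f' := cst 1) mB measurableT _ fB) => //; split => //.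
  exact: finite_measure_integrable_cst.
by move=> A mA; rewrite integral_cst// mul1e m_mu.
Qed.

End disintegration.

Lemma ae_forall_countable d (T : measurableType d) (R : realType)
    (mu : {measure set T -> \bar R}) (I : countType) (P : I -> T -> Prop) :
  (forall i, \forall x \ae mu, P i x) -> \forall x \ae mu, forall i, P i x.
Proof.
move=> aeP; have : \forall x \ae mu, forall n,
    if unpickle n is Some i then P i x else True.
  by apply: ae_foralln => n; case: unpickle => // ; exact: aeW.
by apply: filterS => x + i => /(_ (pickle i)); rewrite pickleK.
Qed.

Definition unif01 (R : realType) : probability (measurableTypeR R) R :=
  uniform_prob (@ltr01 R).

(** This turns a conditional probability [a] into an event driven by uniform noise. *)
Lemma unif01_lt (R : realType) (a : \bar R) : 0 <= a <= 1 ->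
  unif01 R [set u | u%:E < a] = a.
Proof.
move=> /andP[a0 a1].
have fa : a \is a fin_num by rewrite ge0_fin_numE// (le_lt_trans a1)// ltry.
rewrite -(fineK fa) in a0 a1 *; set r := fine a in a0 a1 *.
rewrite !lee_fin in a0 a1.
rewrite [LHS]/(uniform_prob _ _) integral_uniform_pdf.
have -> : [set u | u%:E < r%:E] `&` `[0%R, 1%R] = `[0%R, r[%classic.
  apply/seteqP; split => u /=; rewrite !in_itv/= lte_fin.
    by move=> [-> /andP[-> _]].
  by move=> /andP[-> ur]; split => //; rewrite ltW// (lt_le_trans ur).
rewrite (eq_integral (fun=> 1%:E)); last first.
  move=> u; rewrite inE/= in_itv/= /uniform_pdf => /andP[u0 ur].
  by rewrite u0 (ltW (lt_le_trans ur a1)) subr0 invr1.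
rewrite integral_cst//= mul1e lebesgue_measure_itv/= lte_fin.
case: ifPn => [_|]; first by rewrite -EFinD subr0.
by rewrite -leNgt => r0; congr (_ %:E); apply/eqP; rewrite eq_le a0 r0.
Qed.

Section quantile_coupling.
Context d (T : measurableType d) (R : realType).
Variables (mu : probability T R) (m : probability (T * \bar R)%type R).
Hypothesis m_mu : forall A, measurable A -> m (A `*` setT) = mu A.

Let ray (q : rat) : set (\bar R) := [set y | y < (ratr q : R)%:E].

Let measurable_ray q : measurable (ray q).
Proof.
rewrite (_ : ray q = `]-oo, (ratr q : R)%:E[%classic); 
  first exact: emeasurable_itv.
by apply/seteqP; split => x /=; rewrite in_itv.
Qed.

(** Monotonicity in q and the bound by 1 are countably many almost sure conditions on the densities,
    so one null set [N] carries all exceptions; the value 0 on [N] makes them hold everywhere. *)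
Lemma conditional_cdf : exists F : rat -> T -> \bar R,
  [/\ forall q, measurable_fun setT (F q),
      forall q x, 0 <= F q x <= 1,
      forall q q' x, (q <= q')%R -> F q x <= F q' x &
      forall q A, measurable A -> m (A `*` ray q) = \int[mu]_(x in A) F q x].
Proof.
have /choice[f df] : forall q, exists f, is_section_density mu m (ray q) f.
  by move=> q; exact: section_density.
have mf q : measurable_fun setT (f q) by case: (df q) => _ /measurable_int.
have [N [mN muN0 NP]] : \forall x \ae mu, (forall q, f q x <= 1) /\
    (forall q : rat * rat, (q.1 <= q.2)%R -> f q.1 x <= f q.2 x).
  have h1 : \forall x \ae mu, forall q, f q x <= 1.
    apply: ae_forall_countable => q.
    by apply: (section_density_le1 m_mu _ (df q)).
  have h2 : \forall x \ae mu, forall q : rat * rat,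
      (q.1 <= q.2)%R -> f q.1 x <= f q.2 x.
    apply: ae_forall_countable => -[q q'] /=.
    have [qq'|] := boolP (q <= q')%R; last by move=> _; exact: aeW.
    apply: filterS (section_density_le m_mu _ _ _ (df q) (df q')) => //.
    by move=> y yq; apply: lt_le_trans yq _; rewrite lee_fin ler_rat.
  exact: filterS2 h1 h2.
have out x : ~ N x -> (forall q, f q x <= 1) /\
    (forall q : rat * rat, (q.1 <= q.2)%R -> f q.1 x <= f q.2 x).
  by move=> Nx; apply: contrapT => nP; apply: Nx; exact: NP.
exists (fun q => f q \_ (~` N)); split.
- move=> q; apply/measurable_restrict => //; first exact: measurableC.
  exact: measurable_funTS.
- move=> q x; rewrite patchE; case: ifPn => [/set_mem/out[le1 _]|_].
    by rewrite le1 andbT; case: (df q).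
  by rewrite lexx lee_fin ler01.
- move=> q q' x qq'; rewrite !patchE; case: ifPn => [/set_mem/out[_ le]|//].
  exact: le (q, q') qq'.
- move=> q A mA; case: (df q) => f0 fi -> //.
  apply: ge0_ae_eq_integral => //.
  + exact: measurable_funTS.
  + apply: measurable_funTS; apply/measurable_restrict => //.
      exact: measurableC.
    exact: measurable_funTS.
  + by move=> x _; rewrite patchE; case: ifPn.
  + exists N; split => // x /= /not_implyP[_ fx]; apply: contrapT => Nx.
    by apply: fx; rewrite patchE mem_set.
Qed.


(** [G] is the generalised inverse of the conditional distribution function: at (x, u) it is the
    infimum of the rationals q with u < F q x. It is below r exactly when u < F q x for some
    rational q < r, which yields measurability and law. *)
Lemma quantile_coupling_ray : exists G : T * measurableTypeR R -> \bar R,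
  measurable_fun setT G /\
  forall q A, measurable A ->
    (mu \x unif01 R) [set w | A w.1 /\ ray q (G w)] = m (A `*` ray q).
Proof.
have [F [mF F01 F_le FE]] := conditional_cdf.
pose E q : set (T * measurableTypeR R) := [set w | w.2%:E < F q w.1].
have mE q : measurable (E q).
  rewrite -[E q]setTI; apply: measurable_lte => //; apply: measurableT_comp => //.
(* When no q qualifies, the infimum is [+oo], which lies outside every ray. *)
pose G w := ereal_inf [set (ratr q : R)%:E | q in [set q | E q w]].
have G_lt (r : R) w : G w < r%:E <-> exists2 q, (ratr q < r)%R & E q w.
  split=> [/ereal_inf_lt[_ [q Eq <-] qr]|[q qr Eq]]; first by exists q.
  by apply: le_lt_trans (_ : _ < r%:E); [apply: ereal_inf_lbound; exists q|].
have mG : measurable_fun setT G.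
  apply: (measurability _ (ErealGenInftyO.measurableE R)) => _ [_ [r ->] <-].
  rewrite setTI (_ : _ @^-1` _ =
      \bigcup_q (if (ratr q < r)%R then E q else set0)); last first.
    apply/seteqP; split => [w /=|w].
      by rewrite in_itv/= => /G_lt[q qr Eq]; exists q => //; rewrite qr.
    move=> [q _]; case: ifPn => // qr Eq.
    by rewrite /= in_itv/=; apply/G_lt; exists q.
  by apply: bigcupT_measurable_rat => q; case: ifP.
exists G; split=> // q A mA.
have mAT : measurable (A `*` [set: measurableTypeR R]) by exact: measurableX.
(* For x in [A], the section of [E p] at x is the event that the noise is below [F p x]. *)
have PE p : (mu \x unif01 R) ((A `*` setT) `&` E p) = m (A `*` ray p).
  rewrite FE// [LHS]/product_measure1 [RHS]integral_mkcond.
  apply: eq_integral => x _; rewrite patchE /=; case: ifPn => xA.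
    rewrite -[RHS]unif01_lt//; congr (unif01 R _).
    apply/seteqP; split => u; rewrite /xsection/= inE.
      by move=> [].
    by move=> uF; split => //; split => //; exact/set_mem.
  rewrite -[RHS](measure0 (unif01 R)); congr (unif01 R _).
  apply/seteqP; split => u //; rewrite /xsection/= inE => -[[/= Ax]].
  by rewrite mem_set in xA.
(* [F] is only known to be monotone in q, so the event that [G] is below q is exhausted by the sets
   [E (q_ k)], with [q_ k] increasing to q; the rays at [q_ k] exhaust the ray at q likewise. *)
pose q_ (k : nat) : rat := (q - k.+1%:R^-1)%R.
have q_nd : {homo q_ : k l / (k <= l)%N >-> (k <= l)%R}.
  by move=> k l kl; rewrite lerD2l lerN2 lef_pV2 ?posrE ?ltr0n// ler_nat.
have q_lt k : (q_ k < q)%R by rewrite ltrBlDr ltrDl invr_gt0.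
have q_lim (p : rat) : (p < q)%R -> exists k, (p <= q_ k)%R.
  move=> pq; have pq0 : (0 < q - p)%R by rewrite subr_gt0.
  exists (Num.bound (q - p)^-1)%R; rewrite /q_ lerBrDl -lerBrDr.
  rewrite -[leRHS]invrK lef_pV2 ?posrE ?invr_gt0//.
  rewrite (le_trans (ltW (archi_boundP _))) ?invr_ge0 ?ltW//.
  by rewrite ltr_nat.
have GE : [set w | A w.1 /\ ray q (G w)] = \bigcup_k ((A `*` setT) `&` E (q_ k)).
  apply/seteqP; split => [w [Aw /G_lt[p pq Ep]]|w [k _ [[Aw _] Ek]]].
    rewrite ltr_rat in pq.
    have [k pk] := q_lim _ pq; exists k => //; split => //.
    exact: lt_le_trans Ep (F_le _ _ _ pk).
  by split => //; apply/G_lt; exists (q_ k) => //; rewrite ltr_rat.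
have rayE : A `*` ray q = \bigcup_k (A `*` ray (q_ k)).
  apply/seteqP; split => [[x y] [/= Ax yq]|[x y] [k _ [/= Ax yq]]]; last first.
    by split => //=; apply: lt_trans yq _; rewrite lte_fin ltr_rat.
  have [p yp pq] : exists2 p : rat, y <= (ratr p : R)%:E & (p < q)%R.
    move: y yq => [y| |]; rewrite /ray/= ?ltNge ?leey// -?ltNge => yq.
      rewrite lte_fin in yq; have [p] := rat_in_itvoo yq.
      rewrite in_itv/= => /andP[yp]; rewrite ltr_rat => pq.
      by exists p => //; rewrite lee_fin ltW.
    by exists (q - 1)%R; rewrite ?leNye// ltrBlDr ltrDl.
  (* [yp] and [pk] are large inequalities; the shift to [k.+1] supplies the strict one. *)
  have [k pk] := q_lim _ pq; exists k.+1 => //; split => //=.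
  apply: (le_lt_trans yp); rewrite lte_fin ltr_rat (le_lt_trans pk)//.
  by rewrite ltrD2l ltrN2 ltf_pV2 ?posrE ?ltr0n// ltr_nat.
have mAE k : measurable ((A `*` setT) `&` E (q_ k)) by exact: measurableI.
have mAr k : measurable (A `*` ray (q_ k)) by exact: measurableX.
have c1 := nondecreasing_cvg_mu (mu := mu \x unif01 R) mAE
  (bigcupT_measurable _ mAE).
have c2 := nondecreasing_cvg_mu (mu := m) mAr (bigcupT_measurable _ mAr).
rewrite GE rayE.
apply: (@cvg_unique _ _ (m \o (fun k => A `*` ray (q_ k)) @ \oo)) => //.
  rewrite (_ : _ \o _ = (mu \x unif01 R) \o (fun k => (A `*` setT) `&` E (q_ k))).
    apply: c1 => k l kl; apply/subsetPset => w [Aw Ek]; split => //.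
    by apply: lt_le_trans Ek (F_le _ _ _ _); exact: q_nd.
  by apply/funext => k; rewrite /= PE.
apply: c2 => k l kl; apply/subsetPset => -[x y] [Ax yk]; split => //=.
by apply: lt_le_trans yk _; rewrite lee_fin ler_rat; exact: q_nd.
Qed.

End quantile_coupling.

(** For fixed [A], both laws are finite measures in the second set that agree on rational rays,
    hence everywhere; rectangles then determine the joint law. *)
Lemma quantile_coupling d (T : measurableType d) (R : realType)
    (mu : probability T R) (m : probability (T * \bar R)%type R) :
  (forall A, measurable A -> m (A `*` setT) = mu A) ->
  exists G : T * measurableTypeR R -> \bar R, measurable_fun setT G /\
    has_law (mu \x unif01 R) (fun w => (w.1, G w)) m.
Proof.
move=> m_mu; have [G [mG GE]] := quantile_coupling_ray m_mu.
exists G; split => //.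
have mtG : measurable_fun setT (fun w : T * measurableTypeR R => (w.1, G w)).
  exact: measurable_fun_pair.
have [S [_ SE]] := has_law_ex (mu \x unif01 R) mtG.
split => // C mC; rewrite SE//.
apply: eq_measure_prod => // [|A B mA mB].
  by rewrite [ltLHS](probability_setT S) ltry.
have mAT : measurable (A `*` [set: \bar R]) by exact: measurableX.
have msnd : measurable_fun [set: T * \bar R] snd by exact: measurable_snd.
pose m1_ : {measure set \bar R -> \bar R} := pushforward (mrestr S mAT) snd.
pose m2_ : {measure set \bar R -> \bar R} := pushforward (mrestr m mAT) snd.
have sndE (D : set (\bar R)) : snd @^-1` D `&` A `*` setT = A `*` D.
  by apply/seteqP; split => [[x y] [? []]|[x y] []].
transitivity (m1_ msnd B); first by rewrite /m1_/= /pushforward /mrestr sndE.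
transitivity (m2_ msnd B); last by rewrite /m2_/= /pushforward /mrestr sndE.
have eqray q : S (A `*` [set y | y < (ratr q : R)%:E]) =
               m (A `*` [set y | y < (ratr q : R)%:E]).
  rewrite -GE// -SE//; apply: measurableX => //.
  rewrite (_ : [set _ | _] = `]-oo, (ratr q : R)%:E[%classic).
    exact: emeasurable_itv.
  by apply/seteqP; split => x /=; rewrite in_itv.
apply: eq_measure_ereal mB.
- rewrite /m1_/= /pushforward /mrestr sndE.
  by rewrite (le_lt_trans (probability_le1 _ _)) ?ltry.
- rewrite /m1_ /m2_/= /pushforward /mrestr !sndE m_mu// -SE//.
  rewrite (_ : _ @^-1` _ = A `*` setT).
    rewrite [LHS]product_measure1E// [X in _ * X](probability_setT (unif01 R)).
    by rewrite mule1.
  by apply/seteqP; split => [[x y] []|[x y] []].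
- by move=> q; rewrite /m1_ /m2_/= /pushforward /mrestr !sndE.
Qed.

(* [theta] pulls a sampled extended real back to X without knowing that the
   image of [phi] is measurable. *)
Definition ereal_retract (R : realType) d (X : measurableType d) :=
  exists (phi : X -> \bar R) (theta : \bar R -> X),
    [/\ measurable_fun setT phi, measurable_fun setT theta & cancel phi theta].

(** The second coordinate is sampled as an extended real, through [phi], and mapped back by [theta];
    as [theta] undoes [phi], the joint law is again [m]. *)
Lemma noise_coupling (R : realType) d (T : measurableType d)
    d' (X : measurableType d') (mu : probability T R)
    (m : probability (T * X)%type R) :
  ereal_retract R X -> (forall A, measurable A -> m (A `*` setT) = mu A) ->
  exists G : T * measurableTypeR R -> X, measurable_fun setT G /\
    has_law (mu \x unif01 R) (fun w => (w.1, G w)) m.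
Proof.
move=> [phi [theta [mphi mtheta thetaK]]] m_mu.
have mf : measurable_fun setT (fun z : T * X => (z.1, phi z.2)).
  by apply: measurable_fun_pair => //; exact: measurableT_comp.
have mg : measurable_fun setT (fun z : T * \bar R => (z.1, theta z.2)).
  by apply: measurable_fun_pair => //; exact: measurableT_comp.
have [m' [_ m'E]] := has_law_ex m mf.
have [|G [mG [_ GE]]] := @quantile_coupling _ T R mu m'.
  move=> A mA; rewrite -m'E; last exact: measurableX.
  by rewrite -m_mu//; congr (m _); apply/seteqP; split => [[x y] []|[x y] []].
exists (theta \o G); split; first exact: measurableT_comp.
split; first by apply: measurable_fun_pair => //; exact: measurableT_comp.
move=> C mC.
have mgC : measurable ((fun z : T * \bar R => (z.1, theta z.2)) @^-1` C).
  by rewrite -[_ @^-1` _]setTI; exact: mg.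
rewrite -[LHS]/((mu \x unif01 R) ((fun w => (w.1, G w)) @^-1`
  ((fun z : T * \bar R => (z.1, theta z.2)) @^-1` C))).
rewrite GE// -m'E//; congr (m _); apply/seteqP.
by split => -[x y] /=; rewrite thetaK.
Qed.

(** * Gluing plans into chains *)

(** The new variable is drawn from its conditional law given [x], with fresh noise. The old space
    stays as a factor, so earlier variables survive. *)
Lemma gluing (R : realType) d (Om : measurableType d) d1 (X : measurableType d1)
    d2 (Y : measurableType d2) (P : probability Om R) (mu : probability X R)
    (x : Om -> X) (rho : probability (X * Y)%type R) :
  ereal_retract R Y -> has_law P x mu ->
  (forall A, measurable A -> rho (A `*` setT) = mu A) ->
  exists G : Om * measurableTypeR R -> Y,
    has_law (P \x unif01 R) (fun w => (x w.1, G w)) rho.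
Proof.
move=> Yr xmu rho_mu; have [G [mG GE]] := noise_coupling Yr rho_mu.
exists (fun w => G (x w.1, w.2)).
have idlaw : has_law (unif01 R) id (unif01 R) by split.
exact: (has_law_comp (has_law_prod xmu idlaw) GE).
Qed.

Section path.
Context d1 (X : measurableType d1) d2 (Y : measurableType d2) (R : realType).
Variables (mu : probability X R) (nu : probability Y R).

Definition coupling (rho : probability (X * Y)%type R) :=
  has_law rho fst mu /\ has_law rho snd nu.

(** By induction: [y n.+1] is drawn given [x n] according to [gamma], then [x n.+1] given [y n.+1]
    according to [pi]. The draws are compatible because both plans have marginals [mu] and [nu]. *)
Lemma path_coupling (pi gamma : probability (X * Y)%type R) (n : nat) :
  ereal_retract R X -> ereal_retract R Y -> coupling pi -> coupling gamma ->
  exists d (Om : measurableType d) (P : probability Om R)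
    (x : nat -> Om -> X) (y : nat -> Om -> Y),
    (forall i, (i <= n)%N -> has_law P (fun w => (x i w, y i w)) pi) /\
    (forall i, (i < n)%N -> has_law P (fun w => (x i w, y i.+1 w)) gamma).
Proof.
move=> Xr Yr [pimu pinu] [gammu gamnu].
elim: n => [|n [d [Om [P [x [y [xy xy']]]]]]].
  exists _, _, pi, (fun=> fst), (fun=> snd); split => // i _.
  rewrite (_ : (fun w => _) = id); first by split.
  by apply/funext => -[].
have gam_mu A : measurable A -> gamma (A `*` setT) = mu A.
  move=> mA; case: gammu => _ <-//; congr (gamma _).
  by apply/seteqP; split => [[? ?] []|[? ?]].
have xn_mu : has_law P (x n) mu by exact: (has_law_comp (xy n (leqnn n)) pimu).
have [G1 G1E] := gluing Yr xn_mu gam_mu.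
have G1nu : has_law (P \x unif01 R) G1 nu by exact: (has_law_comp G1E gamnu).
(* Gluing always samples the second coordinate, so drawing x from y uses [pi] with its coordinates
   exchanged. *)
have [pi' pi'E] := has_law_ex pi (@measurable_swap _ _ X Y).
have pi'_nu B : measurable B -> pi' (B `*` setT) = nu B.
  move=> mB; case: pi'E => _ <-; last exact: measurableX.
  case: pinu => _ <-//; congr (pi _).
  by apply/seteqP; split => [[? ?] []|[? ?]].
have [G2 G2E] := gluing Xr G1nu pi'_nu.
have pi'pi : has_law pi' (fun z => (z.2, z.1)) pi.
  split; first exact: measurable_swap.
  move=> A mA; case: pi'E => _ <-.
    by congr (pi _); apply/seteqP; split => -[].
  by rewrite -[_ @^-1` _]setTI; exact: measurable_swap.
have PP : has_law ((P \x unif01 R) \x unif01 R) (fun w => w.1.1) P.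
  exact: (has_law_comp (has_law_fst _ _) (has_law_fst _ _)).
exists _, _, ((P \x unif01 R) \x unif01 R),
  (fun i w => if (i <= n)%N then x i w.1.1 else G2 w),
  (fun i w => if (i <= n)%N then y i w.1.1 else G1 w.1).
split=> i.
  rewrite leq_eqVlt ltnS => /orP[/eqP->|ilen].
    by rewrite ltnn; exact: (has_law_comp G2E pi'pi).
  by rewrite ilen; exact: (has_law_comp PP (xy _ ilen)).
rewrite ltnS leq_eqVlt => /orP[/eqP->|ltin].
  by rewrite eqxx ltnn; exact: (has_law_comp (has_law_fst _ _) G1E).
by rewrite ltin orbT; exact: (has_law_comp PP (xy' _ ltin)).
Qed.

End path.

(** * Cyclical monotonicity along two chains *)

Section cyclic_monotonicity.
Context (X Y : Type) (R : realType).
Variables (c : X * Y -> \bar R) (Gamma : set (X * Y)).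
Hypothesis c_ge0 : forall z, 0 <= c z.
Hypothesis c_cm : forall (n : nat) (z : 'I_n -> X * Y), (forall i, Gamma (z i)) ->
  \sum_(i < n) c (z i) <= \sum_(i < n) c ((z i).1, (z (ordS i)).2).

(** The cyclic successor differs from the usual one only at [n], where it wraps to 0; this isolates
    the closing term. *)
Lemma cyclic_monotone_nat (n : nat) (w : nat -> X * Y) :
  (forall i, (i <= n)%N -> Gamma (w i)) ->
  \sum_(i < n.+1) c (w i) <=
  \sum_(i < n) c ((w i).1, (w i.+1).2) + c ((w n).1, (w 0%N).2).
Proof.
move=> Gw; have := @c_cm n.+1 (fun i => w i) _.
move=> /(_ (fun i => Gw i (ltn_ord i))) /le_trans; apply.
rewrite big_ord_recr /= modnn; apply: leeD => //.
by apply: lee_sum => i _; rewrite modn_small// ltnS.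
Qed.

(** Running through [u] and then [v] gives one cycle of 2n + 2 pairs, whose only mixed costs sit at
    the joints from [u n] to [v 0] and from [v n] to [u 0]. *)
Lemma cyclic_monotone_two_paths (n : nat) (u v : nat -> X * Y) :
  (forall i, (i <= n)%N -> Gamma (u i)) ->
  (forall i, (i <= n)%N -> Gamma (v i)) ->
  \sum_(i < n.+1) c (u i) + \sum_(i < n.+1) c (v i) <=
  \sum_(i < n) c ((u i).1, (u i.+1).2) + \sum_(i < n) c ((v i).1, (v i.+1).2) +
  (c ((u n).1, (v 0%N).2) + c ((v n).1, (u 0%N).2)).
Proof.
move=> Gu Gv.
pose w i := if (i <= n)%N then u i else v (i - n.+1)%N.
have wu i : (i <= n)%N -> w i = u i by rewrite /w => ->.
have wv i : w (n.+1 + i)%N = v i.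
  by rewrite /w addSn ltnNge leq_addr/= -addSn addKn.
have Gw i : (i <= n.+1 + n)%N -> Gamma (w i).
  rewrite /w; case: (leqP i n) => [? _|ni le]; first exact: Gu.
  by apply: Gv; rewrite leq_subLR.
have := cyclic_monotone_nat Gw.
rewrite -[(n.+1 + n).+1]addnS [leLHS]big_split_ord/=.
rewrite [X in _ <= X + _]big_split_ord/=.
rewrite wv (wu 0%N)// [X in _ <= X + _ + _]big_ord_recr/= (wu n)//.
have wn : w n.+1 = v 0%N by rewrite -wv addn0.
rewrite wn.
have e1 : \sum_(i < n.+1) c (w i) = \sum_(i < n.+1) c (u i).
  by apply: eq_bigr => i _; rewrite wu// -ltnS.
have e2 : \sum_(i < n.+1) c (w (n.+1 + i)%N) = \sum_(i < n.+1) c (v i).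
  by apply: eq_bigr => i _; rewrite wv.
have e3 : \sum_(i < n) c ((w i).1, (w i.+1).2) =
    \sum_(i < n) c ((u i).1, (u i.+1).2).
  by apply: eq_bigr => i _; rewrite !wu// ltnW.
have e4 : \sum_(i < n) c ((w (n.+1 + i)%N).1, (w (n.+1 + i).+1).2) =
    \sum_(i < n) c ((v i).1, (v i.+1).2).
  by apply: eq_bigr => i _; rewrite -addnS !wv.
rewrite e1 e2 e3 e4 => /le_trans; apply; rewrite -!addeA leeD2l//.
by rewrite addeCA.
Qed.

(** The left side has 2(n + 1) terms, each at most [M], so it is at most [L]. If a closing cost
    reaches [L], its truncation alone dominates; otherwise truncation leaves both closing costs
    unchanged. *)
Lemma truncated_cyclic_monotone (n : nat) (M : R) (u v : nat -> X * Y) :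
  (0 <= M)%R ->
  (forall i, (i <= n)%N -> Gamma (u i)) ->
  (forall i, (i <= n)%N -> Gamma (v i)) ->
  \sum_(i < n.+1) mine (c (u i)) M%:E + \sum_(i < n.+1) mine (c (v i)) M%:E <=
  \sum_(i < n) c ((u i).1, (u i.+1).2) + \sum_(i < n) c ((v i).1, (v i.+1).2) +
  (mine (c ((u n).1, (v 0%N).2)) (n.+1%:R * (M + M))%:E +
   mine (c ((v n).1, (u 0%N).2)) (n.+1%:R * (M + M))%:E).
Proof.
move=> M0 Gu Gv; set L := (n.+1%:R * (M + M))%:E.
have L0 : 0 <= L by rewrite lee_fin mulr_ge0// addr_ge0.
have sum_le_L : \sum_(i < n.+1) mine (c (u i)) M%:E +
    \sum_(i < n.+1) mine (c (v i)) M%:E <= L.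
  have bnd (s : nat -> X * Y) :
      \sum_(i < n.+1) mine (c (s i)) M%:E <= (n.+1%:R * M)%:E.
    apply: (@le_trans _ _ (\sum_(i < n.+1) M%:E)).
      by apply: lee_sum => i _; rewrite ge_min lexx orbT.
    by rewrite sumEFin sumr_const card_ord mulr_natl.
  by apply: (le_trans (leeD (bnd _) (bnd _))); rewrite -EFinD -mulrDr.
have sum_ge0 (s : nat -> X * Y) : 0 <= \sum_(i < n) c ((s i).1, (s i.+1).2).
  exact: sume_ge0.
have min_ge0 z : 0 <= mine (c z) L by rewrite le_min c_ge0.
have [cL|cL] := leP L (c ((u n).1, (v 0%N).2)).
  apply: (le_trans sum_le_L).
  by rewrite addeCA leeDl// !adde_ge0.
have [c'L|c'L] := leP L (c ((v n).1, (u 0%N).2)).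
  apply: (le_trans sum_le_L).
  by rewrite addeA leeDr// !adde_ge0// ltW.
apply: le_trans (cyclic_monotone_two_paths Gu Gv).
by apply: leeD; apply: lee_sum => i _; rewrite ge_min lexx.
Qed.

End cyclic_monotonicity.

(** * Comparison of costs by integration along the chains *)

Section cyclically_monotone_coupling.
Context d1 (X : measurableType d1) d2 (Y : measurableType d2) (R : realType).
Variables (mu : probability X R) (nu : probability Y R).
Variables (pi gamma : probability (X * Y)%type R).
Variables (c : X * Y -> \bar R) (Gamma : set (X * Y)).
Hypotheses (retractX : ereal_retract R X) (retractY : ereal_retract R Y).
Hypotheses (pi_cpl : coupling mu nu pi) (gamma_cpl : coupling mu nu gamma).
Hypothesis c_ge0 : forall z, 0 <= c z.
Hypothesis c_meas : measurable_fun setT c.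
Hypothesis c_fin : {ae (mu \x nu), forall z, c z < +oo}.
Hypothesis Gamma_meas : measurable Gamma.
Hypothesis c_cm : forall (n : nat) (z : 'I_n -> X * Y), (forall i, Gamma (z i)) ->
  \sum_(i < n) c (z i) <= \sum_(i < n) c ((z i).1, (z (ordS i)).2).
Hypothesis pi_Gamma : pi Gamma = 1.

Lemma integral_sum_law d (T : measurableType d) (Q : probability T R) (n : nat)
    (z : nat -> T -> X * Y) (rho : probability (X * Y)%type R)
    (f : X * Y -> \bar R) :
  measurable_fun setT f -> (forall p, 0 <= f p) ->
  (forall i, (i < n)%N -> has_law Q (z i) rho) ->
  measurable_fun setT (fun w => \sum_(i < n) f (z i w)) /\
  \int[Q]_w \sum_(i < n) f (z i w) = (\int[rho]_p f p) *+ n.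
Proof.
move=> mf f0 zrho.
have mfz (i : 'I_n) : measurable_fun setT (fun w => f (z i w)).
  by apply: measurableT_comp => //; case: (zrho _ (ltn_ord i)).
split; first exact: emeasurable_sum.
rewrite ge0_integral_sum//.
transitivity (\sum_(i < n) \int[rho]_p f p); last by rewrite sumr_const card_ord.
by apply: eq_bigr => i _; apply: has_law_integral => //; exact: zrho.
Qed.

Lemma ae_has_law d (T : measurableType d) (Q : probability T R)
    (f : T -> X * Y) : has_law Q f pi -> \forall w \ae Q, Gamma (f w).
Proof.
move=> [mf Qf]; exists (f @^-1` (~` Gamma)); split => //.
  by rewrite -[_ @^-1` _]setTI; apply: mf => //; exact: measurableC.
rewrite Qf; last exact: measurableC.
by rewrite probability_setC// pi_Gamma subee.
Qed.

(** The pathwise inequality is integrated over two independent copies of the chain; independence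
    gives both closing pairs the law [mu \x nu]. *)
Lemma truncated_cost_le (n : nat) (M : R) : (0 <= M)%R ->
  (\int[pi]_z mine (c z) M%:E) *+ n.+1 + (\int[pi]_z mine (c z) M%:E) *+ n.+1 <=
  (\int[gamma]_z c z) *+ n + (\int[gamma]_z c z) *+ n +
  (\int[mu \x nu]_z mine (c z) (n.+1%:R * (M + M))%:E +
   \int[mu \x nu]_z mine (c z) (n.+1%:R * (M + M))%:E).
Proof.
move=> M0; set L : R := (n.+1%:R * (M + M))%R.
have L0 : (0 <= L)%R by rewrite mulr_ge0// addr_ge0.
have [d [Om [P [x [y [xy xy']]]]]] :=
  path_coupling n retractX retractY pi_cpl gamma_cpl.
pose Q := P \x P.
have PPfst : has_law Q fst P := has_law_fst P P.
have PPsnd : has_law Q snd P := has_law_snd P P.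
have ulaw i : (i < n.+1)%N -> has_law Q (fun w => (x i w.1, y i w.1)) pi.
  by move=> ilen; exact: (has_law_comp PPfst (xy _ ilen)).
have vlaw i : (i < n.+1)%N -> has_law Q (fun w => (x i w.2, y i w.2)) pi.
  by move=> ilen; exact: (has_law_comp PPsnd (xy _ ilen)).
have u'law i : (i < n)%N -> has_law Q (fun w => (x i w.1, y i.+1 w.1)) gamma.
  by move=> ilen; exact: (has_law_comp PPfst (xy' _ ilen)).
have v'law i : (i < n)%N -> has_law Q (fun w => (x i w.2, y i.+1 w.2)) gamma.
  by move=> ilen; exact: (has_law_comp PPsnd (xy' _ ilen)).
have xn : has_law P (x n) mu by exact: (has_law_comp (xy n (leqnn n)) pi_cpl.1).
have y0 : has_law P (y 0%N) nu by exact: (has_law_comp (xy 0%N (leq0n n)) pi_cpl.2).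
have xilaw : has_law Q (fun w => (x n w.1, y 0%N w.2)) (mu \x nu).
  exact: has_law_prod.
have xi'law : has_law Q (fun w => (x n w.2, y 0%N w.1)) (mu \x nu).
  exact: (has_law_comp (has_law_swap P P) xilaw).
have mmin (r : R) : measurable_fun setT (fun z => mine (c z) r%:E).
  exact: measurable_mine.
have min0 (r : R) : (0 <= r)%R -> forall z, 0 <= mine (c z) r%:E.
  by move=> r0 z; rewrite le_min c_ge0.
have [mA1 A1] := integral_sum_law (mmin M) (min0 M M0) ulaw.
have [mA2 A2] := integral_sum_law (mmin M) (min0 M M0) vlaw.
have [mB1 B1] := integral_sum_law c_meas c_ge0 u'law.
have [mB2 B2] := integral_sum_law c_meas c_ge0 v'law.
have mK1 : measurable_fun setT (fun w => mine (c (x n w.1, y 0%N w.2)) L%:E).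
  by apply: (measurableT_comp (mmin L)); case: xilaw.
have mK2 : measurable_fun setT (fun w => mine (c (x n w.2, y 0%N w.1)) L%:E).
  by apply: (measurableT_comp (mmin L)); case: xi'law.
have K1 := has_law_integral xilaw (mmin L) (min0 L L0).
have K2 := has_law_integral xi'law (mmin L) (min0 L L0).
(* Each integral occurs twice: the first occurrence is read on one chain, the second on its copy. *)
rewrite -{1}A1 -A2 -{1}B1 -B2 -{1}K1 -K2.
have s0 k (f : X * Y -> \bar R) (z : 'I_k -> X * Y) : (forall p, 0 <= f p) ->
    0 <= \sum_(i < k) f (z i) by move=> f0; exact: sume_ge0.
rewrite -!ge0_integralD//; last 10 first.
- by move=> w _; rewrite adde_ge0// (s0 n c).
- exact: emeasurable_funD.
- by move=> w _; rewrite adde_ge0// min0.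
- exact: emeasurable_funD.
- by move=> w _; exact: (s0 n c).
- by move=> w _; exact: (s0 n c).
- by move=> w _; exact: (s0 n.+1 _ _ (min0 M M0)).
- by move=> w _; exact: (s0 n.+1 _ _ (min0 M M0)).
- by move=> w _; exact: min0.
- by move=> w _; exact: min0.
apply: ae_ge0_le_integral => //.
- by move=> w _; rewrite adde_ge0// (s0 n.+1 _ _ (min0 M M0)).
- exact: emeasurable_funD.
- by move=> w _; rewrite !adde_ge0// ?min0// (s0 n c).
- by apply: emeasurable_funD; exact: emeasurable_funD.
have aeG : \forall w \ae Q, forall i, (i <= n)%N ->
    Gamma (x i w.1, y i w.1) /\ Gamma (x i w.2, y i w.2).
  apply: ae_foralln => i; have [ilen|_] := leqP i n; last exact: aeW.
  by apply: filterS2 (ae_has_law (ulaw i ilen)) (ae_has_law (vlaw i ilen)).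
apply: filterS aeG => w Gw _.
apply: (@truncated_cyclic_monotone X Y R c Gamma c_ge0 c_cm n M
  (fun i => (x i w.1, y i w.1)) (fun i => (x i w.2, y i w.2)) M0).
- by move=> i /Gw[].
- by move=> i /Gw[].
Qed.

(** Dominated convergence: the constant [M] dominates, and wherever [c] is finite the integrand is
    at most c / (n + 1). *)
Lemma closing_cost_cvg0 (M : R) : (0 <= M)%R ->
  \int[mu \x nu]_z mine ((n.+1%:R^-1)%:E * c z) M%:E @[n --> \oo] --> 0.
Proof.
move=> M0.
have mf n : measurable_fun setT (fun z => mine ((n.+1%:R^-1 : R)%:E * c z) M%:E).
  by apply: measurable_mine => //; exact: measurable_funeM.
have f0 (n : nat) z : 0 <= mine ((n.+1%:R^-1 : R)%:E * c z) M%:E.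
  by rewrite le_min lee_fin M0 mule_ge0.
pose munu : probability (X * Y)%type R := mu \x nu.
have ig : munu.-integrable setT (cst M%:E).
  exact: (finite_measure_integrable_cst munu M measurableT).
have f_cvg : {ae munu, forall z, setT z ->
    mine ((n.+1%:R^-1)%:E * c z) M%:E @[n --> \oo] --> (0 : \bar R)}.
  apply: filterS c_fin => z cz _.
  have cfin : c z \is a fin_num by rewrite ge0_fin_numE.
  apply: (@squeeze_cvge _ _ _ _ (cst 0) _ (fun n => (harmonic n * fine (c z))%:E)).
  - by apply: nearW => n /=; rewrite f0 /= ge_min /harmonic EFinM fineK// lexx.
  - exact: cvg_cst.
  - apply: cvg_EFin; first exact: nearW.
    rewrite -[X in _ --> X](mul0r (fine (c z))).
    by apply: cvgMl; exact: cvg_harmonic.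
have f_le : {ae munu, forall z n, setT z ->
    `|mine ((n.+1%:R^-1)%:E * c z) M%:E| <= cst M%:E z}.
  by apply: aeW => z n _ /=; rewrite gee0_abs// ge_min lexx orbT.
have [_ _] := dominated_convergence measurableT mf (measurable_cst 0) f_cvg ig f_le.
by rewrite integral0.
Qed.

(** After division by 2(n + 1), only a vanishing closing term is left beside the cost of [gamma].
    Its finiteness lets the arithmetic take place in the reals. *)
Lemma truncated_cost_le_cost (M : R) : (0 <= M)%R ->
  \int[gamma]_z c z < +oo ->
  \int[pi]_z mine (c z) M%:E <= \int[gamma]_z c z.
Proof.
move=> M0 Coo.
have M20 : (0 <= M + M)%R by rewrite addr_ge0.
have C0 : 0 <= \int[gamma]_z c z by exact: integral_ge0.
have mmin (r : R) : measurable_fun setT (fun z => mine (c z) r%:E).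
  exact: measurable_mine.
have min0 (r : R) : (0 <= r)%R -> forall z, 0 <= mine (c z) r%:E.
  by move=> r0 z; rewrite le_min c_ge0.
have bnd (rho : probability (X * Y)%type R) (g : X * Y -> \bar R) (r : R) :
    measurable_fun setT g -> (forall z, 0 <= g z <= r%:E) ->
    \int[rho]_z g z \is a fin_num.
  move=> mg g0r; have g0 z : 0 <= g z by case/andP: (g0r z).
  rewrite ge0_fin_numE; last exact: integral_ge0.
  apply: (@le_lt_trans _ _ (\int[rho]_z r%:E)).
    by apply: ge0_le_integral => // z _; case/andP: (g0r z).
  by rewrite integral_cst// [X in _ * X](probability_setT rho) mule1 ltry.
have min_bnd (r : R) : (0 <= r)%R -> forall z, 0 <= mine (c z) r%:E <= r%:E.
  by move=> r0 z; rewrite min0// ge_min lexx orbT.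
have step n : \int[pi]_z mine (c z) M%:E <= \int[gamma]_z c z +
    \int[mu \x nu]_z mine ((n.+1%:R^-1)%:E * c z) (M + M)%:E.
  have := truncated_cost_le n M0.
  have L0 : (0 <= n.+1%:R * (M + M) :> R)%R by rewrite mulr_ge0.
  (* The truncation level n.+1 * (M + M) was proportional to n + 1, so dividing by n + 1 leaves the
     fixed level M + M. *)
  have -> : \int[mu \x nu]_z mine ((n.+1%:R^-1)%:E * c z) (M + M)%:E =
      (n.+1%:R^-1)%:E * \int[mu \x nu]_z mine (c z) (n.+1%:R * (M + M))%:E.
    rewrite -ge0_integralZl//; last by move=> z _; exact: min0.
    apply: eq_integral => z _; rewrite mine_pMr ?lee_fin ?invr_ge0//.
    by rewrite -EFinM mulKf.
  rewrite -(fineK (bnd pi _ M (mmin M) (min_bnd M M0)))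
    -(fineK (bnd (mu \x nu) _ _ (mmin _) (min_bnd _ L0))).
  have -> : \int[gamma]_z c z = (fine (\int[gamma]_z c z))%:E.
    by rewrite fineK// ge0_fin_numE.
  rewrite -!EFin_natmul -!EFinM -!EFinD !lee_fin.
  set I := fine _; set C := fine _; set K := fine _ => le.
  have C0' : (0 <= C)%R by exact: fine_ge0.
  rewrite -(@ler_pM2l _ n.+1%:R)// mulrDr mulrA divff// mul1r.
  (* There are n links of law [gamma] against n + 1 pairs of law [pi]; adding the missing
     nonnegative cost evens the counts. *)
  have CnC : (C *+ n <= C *+ n.+1)%R by rewrite mulrS lerDr.
  by rewrite !mulr_natl; lra.
apply/lee_addgt0Pr => e e0.
have /fine_cvgP[_ /cvgrPdist_lt/(_ e e0)[n _ /(_ n (leqnn n))]] :=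
  closing_cost_cvg0 M20.
rewrite /= sub0r normrN => Je.
apply: (le_trans (step n)); rewrite leeD2l//.
have Jfin : \int[mu \x nu]_z mine ((n.+1%:R^-1)%:E * c z) (M + M)%:E \is a fin_num.
  apply: (bnd (mu \x nu) _ (M + M)%R).
    by apply: measurable_mine => //; exact: measurable_funeM.
  by move=> z; rewrite le_min lee_fin M20 mule_ge0//= ge_min lexx orbT.
by rewrite -(fineK Jfin) lee_fin (le_trans (ler_norm _))// ltW.
Qed.

(** An infinite cost of [gamma] is trivial; otherwise monotone convergence along integer truncation
    levels removes [M]. *)
Lemma cyclically_monotone_cost_le : \int[pi]_z c z <= \int[gamma]_z c z.
Proof.
have [->|] := eqVneq (\int[gamma]_z c z) +oo; first exact: leey.
rewrite -ltey => Coo.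
have nd z : {homo (fun n => mine (c z) (n%:R : R)%:E) :
    m n / (m <= n)%N >-> m <= n}.
  by move=> m n mn; rewrite le_min !ge_min lexx/= lee_fin ler_nat mn orbT.
have mmin n : measurable_fun setT (fun z => mine (c z) (n%:R : R)%:E).
  exact: measurable_mine.
have min0 n z : 0 <= mine (c z) (n%:R : R)%:E by rewrite le_min c_ge0 lee_fin ler0n.
have limE z : limn (fun n => mine (c z) (n%:R : R)%:E) = c z.
  apply/cvg_lim => //; case: (c z) (c_ge0 z) => [r| |//] r0.
    apply: cvg_near_cst; near=> n; apply/min_idPl; rewrite lee_fin ltW//.
    by near: n; exact: nbhs_infty_gtr.
  rewrite (_ : (fun _ => _) = (fun n => (n%:R : R)%:E)); last first.
    by apply/funext => n; rewrite minye.
  by apply/cvgeryP; exact: cvgr_idn.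
have := @cvg_monotone_convergence _ _ _ pi setT measurableT
  (fun n z => mine (c z) (n%:R : R)%:E) mmin.
move=> /(_ (fun n z _ => min0 n z) (fun z _ => nd z)).
under eq_integral => z _ do rewrite limE.
move=> cv; rewrite -(cvg_lim _ cv)//; apply: lime_le.
  by apply/cvg_ex; eexists; exact: cv.
by apply: nearW => n; exact: truncated_cost_le_cost.
Unshelve. all: by end_near. Qed.

End cyclically_monotone_coupling.

(** * Polish spaces as retracts of the extended reals *)

Section ternary_code.
Context (R : realType).

Let t (k : nat) : R := 3%:R ^- k.

Let t_gt0 k : (0 < t k)%R. Proof. by rewrite invr_gt0 exprn_gt0. Qed.

Let tS k : t k = (3 * t k.+1)%R.
Proof. by rewrite /t exprS invfM mulrA divff// mul1r. Qed.

(** Greedy base 3 expansion with digits 0 and 1 only, weights starting at 3^0. It is defined on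
    every extended real, so that decoding is total. *)
Fixpoint ternary_prefix (n : nat) (r : \bar R) : R :=
  if n is k.+1 then
    (ternary_prefix k r +
     if ((ternary_prefix k r + t k)%:E <= r)%E then t k else 0)%R
  else 0%R.

Definition ternary_digit (k : nat) : set (\bar R) :=
  [set r | (ternary_prefix k r + t k)%:E <= r].

Lemma measurable_ternary_prefix n : measurable_fun setT (ternary_prefix n).
Proof.
elim: n => [|n IHn] /=; first exact: measurable_cst.
apply: measurable_funD => //; apply: measurable_fun_ifT => //.
apply: measurable_fun_lee => //.
by apply/measurable_EFinP; exact: measurable_funD.
Qed.

Lemma measurable_ternary_digit k : measurable (ternary_digit k).
Proof.
rewrite -[ternary_digit k]setTI; apply: measurable_lee => //.
by apply/measurable_EFinP; apply: measurable_funD => //; exact: measurable_ternary_prefix.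
Qed.

(** [e x] sums 3^-k over the k with x in [B k]. The terms after k add up to at most half of 3^-k, so
    greedy decoding reads the memberships back. *)
Lemma ternary_code d (X : measurableType d) (B : nat -> set X) :
  (forall k, measurable (B k)) ->
  exists e : X -> \bar R, measurable_fun setT e /\
    forall k x, ternary_digit k (e x) <-> B k x.
Proof.
move=> mB; pose s n x : R := (\sum_(k < n) t k * \1_(B k) x)%R.
pose e x := ereal_sup (range (fun n => (s n x)%:E)).
have sS n x : (s n.+1 x = s n x + t n * \1_(B n) x)%R by rewrite /s big_ord_recr.
have s_le_e n x : (s n x)%:E <= e x by apply: ereal_sup_ubound; exists n.
have s_nd x : {homo s^~ x : m n / (m <= n)%N >-> (m <= n)%R}.
  apply: homo_leq => // [y u v|n]; first exact: le_trans.
  by rewrite sS lerDl indicE mulr_ge0// ltW.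
have s_tail x : {homo (fun n => s n x + 3 / 2 * t n)%R : m n /
    (m <= n)%N >-> (n <= m)%R}.
  (* 3 / 2 * t n is the sum of all t k with k >= n *)
  apply: (@homo_leq _ _ (fun a b => b <= a)%R) => // [y u v uy /le_trans|n].
    exact.
  rewrite sS (tS n) indicE; have := t_gt0 n.+1.
  by case: (_ \in _) => /=; lra.
have e_le n x : e x <= (s n x + 3 / 2 * t n)%:E.
  apply: ub_ereal_sup => _ [m _ <-]; rewrite lee_fin.
  apply: (@le_trans _ _ (s (maxn n m) x)); first by rewrite s_nd// leq_maxr.
  apply: (@le_trans _ _ (s (maxn n m) x + 3 / 2 * t (maxn n m))%R).
    by rewrite lerDl mulr_ge0// ltW.
  by rewrite s_tail// leq_maxl.
have digitE k x : (((s k x + t k)%:E <= e x) = (x \in B k)).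
  apply/idP/idP => [|xB].
    (* With digit k equal to 0, [e x] is at most s_k + (3/2) t_(k+1) = s_k + t_k / 2, below the
       threshold s_k + t_k. *)
    apply: contraLR => xB; rewrite -ltNge (le_lt_trans (e_le k.+1 x))// lte_fin.
    rewrite sS indicE (negbTE xB) (tS k) /=; have := t_gt0 k.+1; lra.
  by apply: le_trans (s_le_e k.+1 x); rewrite sS indicE xB mulr1.
have prefixE k x : ternary_prefix k (e x) = s k x.
  elim: k => [|k IHk] /=; first by rewrite /s big_ord0.
  rewrite IHk digitE sS indicE; case: (x \in B k); by rewrite ?mulr1 ?mulr0.
exists e; split.
  apply: (measurability _ (ErealGenOInfty.measurableE R)) => _ [_ [r ->] <-].
  rewrite setTI (_ : _ @^-1` _ = \bigcup_n [set x | r%:E < (s n x)%:E]).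
    apply: bigcupT_measurable => n; rewrite -[X in measurable X]setTI.
    apply: measurable_lte => //; apply/measurable_EFinP.
    apply: measurable_sum => k; exact: measurable_funM.
  apply/seteqP; split => x /=; rewrite in_itv/= andbT.
    by move=> /ereal_sup_gt[_ [n _ <-] rs]; exists n.
  by move=> [n _ rs]; exact: lt_le_trans (s_le_e n x).
move=> k x; rewrite /ternary_digit/= prefixE digitE.
by split => [/set_mem|/mem_set].
Qed.

End ternary_code.

Section polish_retract.
Context (R : realType) (X : ptopologicalType) (dist : X -> X -> R).
Hypothesis dist_metric : is_metric dist.
Hypothesis dist_top : metric_induces_topology dist.
Hypothesis dist_complete : metric_complete dist.

Let dist_ge0 x y : (0 <= dist x y)%R. Proof. by case: dist_metric. Qed.
Let distC x y : dist x y = dist y x. Proof. by case: dist_metric. Qed.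
Let dist_triangle x y z : (dist x z <= dist x y + dist y z)%R.
Proof. by case: dist_metric. Qed.
Let dist0 x y : dist x y = 0%R <-> x = y. Proof. by case: dist_metric. Qed.
Let distxx x : dist x x = 0%R. Proof. exact/dist0. Qed.

Lemma open_metric_ball x (e : R) : open [set y | (dist x y < e)%R].
Proof.
rewrite openE => y /= xy; apply/(dist_top y).
exists (e - dist x y)%R; first by rewrite subr_gt0.
by move=> z /=; rewrite ltrBrDl; apply: le_lt_trans.
Qed.

Lemma dense_sequence : separable X ->
  exists u : nat -> X, forall x (e : R), (0 < e)%R -> exists i, (dist (u i) x < e)%R.
Proof.
move=> [D /countable_injP[f f_inj] D_dense].
have D_near x e : (0 < e)%R -> exists2 y, D y & (dist y x < e)%R.
  move=> e0; have [||y [/= xy Dy]] := D_dense [set y | (dist x y < e)%R].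
  - by exists x; rewrite /= distxx.
  - exact: open_metric_ball.
  - by exists y => //; rewrite distC.
(* The sequence inverts the injection [f] of [D] into the naturals, with value [point] off its
   range. *)
exists (fun n => xget point [set y | D y /\ f y = n]) => x e /(D_near x)[y Dy yx].
exists (f y); case: xgetP => [z _ [Dz fz]|/(_ y)]; last by case.
suff -> : z = y by [].
by apply: f_inj; rewrite ?inE.
Qed.

Let r2 (k : nat) : R := 2%:R ^- k.
Let r2_gt0 k : (0 < r2 k)%R. Proof. by rewrite invr_gt0 exprn_gt0. Qed.
Let r2S k : r2 k = (2 * r2 k.+1)%R.
Proof. by rewrite /r2 exprS invfM mulrA divff// mul1r. Qed.
Let r2_lt (e : R) : (0 < e)%R -> exists k, (r2 k < e)%R.
Proof.
move=> e0; have [k ek] : exists k : nat, (e^-1 < k%:R)%R.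
  by exists (Num.bound e^-1); rewrite archi_boundP// invr_ge0 ltW.
exists k; rewrite -[ltRHS]invrK ltf_pV2 ?posrE ?invr_gt0 ?exprn_gt0//.
by rewrite (lt_le_trans ek)// -natrX ler_nat ltnW// ltn_expl.
Qed.

Section fast_limit.
Context d (S : measurableType d) (u : nat -> X) (N : nat -> S -> nat).
Hypothesis mN : forall j i, measurable [set s | N j s = i].

(** Such steps are summable, so the centres converge. Centres within 2^-j of a common point qualify,
    as 2^-j + 2^-(j+1) < 2 * 2^-j. *)
Let fast : set S :=
  [set s | forall j, (dist (u (N j s)) (u (N j.+1 s)) < 2 * r2 j)%R].

Let measurable_fast : measurable fast.
Proof.
rewrite (_ : fast = \bigcap_j \bigcup_i \bigcup_k
    (if (dist (u i) (u k) < 2 * r2 j)%R then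
      [set s | N j s = i] `&` [set s | N j.+1 s = k] else set0)); last first.
  apply/seteqP; split => [s fs j _|s fs j].
    by exists (N j s) => //; exists (N j.+1 s) => //; rewrite fs.
  by have [i _ [k _]] := fs j Logic.I; case: ifPn => // lt [-> ->].
apply: bigcapT_measurable => j; apply: bigcupT_measurable => i.
by apply: bigcupT_measurable => k; case: ifP => // _; exact: measurableI.
Qed.

Let fast_dist s j m : fast s ->
  (dist (u (N j s)) (u (N (j + m)%N s)) <= 4 * (r2 j - r2 (j + m)%N))%R.
Proof.
move=> fs; elim: m => [|m IHm]; first by rewrite addn0 distxx subrr mulr0.
apply: le_trans (dist_triangle _ (u (N (j + m)%N s)) _) _.
have := fs (j + m)%N; rewrite addnS; have := r2S (j + m)%N; lra.
Qed.

(** The premise [fast s] sits under the existential so that choice yields a map on all of [S]. *)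
Lemma fast_limit_ex s : exists x, fast s ->
  forall j, (dist (u (N j s)) x <= 4 * r2 j)%R.
Proof.
have [fs|nfs] := pselect (fast s); last by exists point.
have cauchy j k : (j <= k)%N -> (dist (u (N j s)) (u (N k s)) <= 4 * r2 j)%R.
  move=> jk; have := fast_dist j (k - j)%N fs.
  by rewrite subnKC//; have := r2_gt0 k; lra.
have [e e0|x xlim] := dist_complete (u := fun j => u (N j s)).
  have [k ke] : exists k, (r2 k < e / 8)%R by apply: r2_lt; rewrite divr_gt0.
  exists k => m n km kn; apply: le_lt_trans (dist_triangle _ (u (N k s)) _) _.
  rewrite distC; have := cauchy _ _ km; have := cauchy _ _ kn; lra.
exists x => _ j; apply/ler_addgt0Pr => e e0.
have [n xn] := xlim e e0.
apply: le_trans (dist_triangle _ (u (N (maxn j n) s)) _) _.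
apply: lerD; first by apply: cauchy; exact: leq_maxl.
by rewrite distC ltW// xn// leq_maxr.
Qed.

Lemma fast_limit : exists theta : S -> borel X,
  measurable_fun setT theta /\
  forall s x, (forall j, (dist (u (N j s)) x < r2 j)%R) -> theta s = x.
Proof.
have /choice[th thE] := fast_limit_ex.
pose theta s := if s \in fast then th s else point.
exists theta; split.
  apply: (@measurability _ _ S (borel X) setT _ (@open X) erefl) => // _ [V oV <-].
  (* On [fast], the limit lies in the open set [V] exactly when [V] contains, for some j, the closed
     ball of radius 4 * 2^-j about the j-th centre, which always contains the limit. *)
  rewrite setTI (_ : _ @^-1` _ =
    (fast `&` \bigcup_j \bigcup_i
       (if `[< [set y | (dist (u i) y <= 4 * r2 j)%R] `<=` V >] then
          [set s | N j s = i] else set0)) `|`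
    (if point \in V then ~` fast else set0)); last first.
    apply/seteqP; split => s; rewrite /= /theta.
      case: ifPn => [/set_mem fs|/negP nfs] Vs; last first.
        by right; rewrite mem_set// => /mem_set.
      left; split => //.
      have [e e0 eO] : exists2 e : R,
          (0 < e)%R & [set y | (dist (th s) y < e)%R] `<=` V.
        by apply/dist_top; exact: open_nbhs_nbhs.
      (* Two points of a ball of radius 4 * 2^-k are at most 8 * 2^-k apart. *)
      have [k ke] : exists k, (r2 k < e / 8)%R by apply: r2_lt; rewrite divr_gt0.
      exists k => //; exists (N k s) => //.
      rewrite ifT//; apply/asboolP => y /= ky; apply: eO => /=.
      apply: le_lt_trans (dist_triangle _ (u (N k s)) _) _.
      by rewrite distC; have := thE s fs k; lra.
    move=> [[fs [j _ [i _]]]|].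
      case: ifPn => // /asboolP iO Ni; rewrite mem_set//; apply: iO => /=.
      by rewrite -Ni; exact: thE.
    by case: ifPn => // /set_mem pO nfs; rewrite memNset.
  apply: measurableU.
    apply: measurableI => //; apply: bigcupT_measurable => j.
    by apply: bigcupT_measurable => i; case: ifP.
  by case: ifP => // _; exact: measurableC.
move=> s x sx.
have fs : fast s.
  move=> j; apply: le_lt_trans (dist_triangle _ x _) _.
  rewrite [dist x _]distC.
  have := sx j; have := sx j.+1; have := r2S j; have := r2_gt0 j.+1; lra.
rewrite /theta mem_set//; apply/dist0/eqP; rewrite eq_le dist_ge0 andbT.
apply/ler_addgt0Pr => e e0; rewrite add0r.
have [k ke] : exists k, (r2 k < e / 8)%R by apply: r2_lt; rewrite divr_gt0.
apply: le_trans (dist_triangle _ (u (N k s)) _) _.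
rewrite distC; have := thE s fs k; have := sx k; lra.
Qed.

End fast_limit.

End polish_retract.

(** [N] selects the least admissible index, or 0 if there is none; both cases are countable
    conditions on the sets [A i]. *)
Lemma measurable_least_index d (S : measurableType d) (A : nat -> set S) :
  (forall i, measurable (A i)) ->
  exists N : S -> nat, (forall i, measurable [set s | N s = i]) /\
    forall s, (exists i, A i s) -> A (N s) s.
Proof.
move=> mA.
have least s : exists n, (A n s /\ forall m, (m < n)%N -> ~ A m s) \/
    (n = 0%N /\ forall m, ~ A m s).
  have [[i Ais]|nA] := pselect (exists i, A i s); last first.
    by exists 0%N; right; split => // m Ams; apply: nA; exists m.
  have exA : exists i, `[< A i s >] by exists i; exact/asboolP.
  case: (ex_minnP exA) => n /asboolP Ans n_min; exists n; left; split => // m mn.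
  by move=> /asboolP/n_min; rewrite leqNgt mn.
have /choice[N NP] := least; exists N; split => [i|s [i Ais]]; last first.
  by case: (NP s) => -[// _ nA]; case: (nA i).
rewrite (_ : [set s | N s = i] =
    (A i `&` \bigcap_m (if (m < i)%N then ~` A m else setT)) `|`
    (if i == 0%N then \bigcap_m ~` A m else set0)); last first.
  apply/seteqP; split => s /=.
    move=> <-; case: (NP s) => -[As nA]; [left|right].
      by split => // m _; case: ifPn => // /nA.
    by rewrite As eqxx => m _; exact: nA.
  move=> [[Ais lt_i]|].
    case: (NP s) => -[ANs N_min]; last by case: (N_min i).
    have [/N_min//|Ni|//] := ltngtP i (N s).
    by have := lt_i (N s) Logic.I; rewrite Ni => /(_ ANs).
  case: eqP => // -> nA; case: (NP s) => -[] // ANs _.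
  by case: (nA (N s)).
apply: measurableU.
  apply: measurableI => //; apply: bigcapT_measurable => m.
  by case: ifP => // _; exact: measurableC.
by case: ifP => // _; apply: bigcapT_measurable => m; exact: measurableC.
Qed.

(** A point is coded by the balls of radius 2^-j about a dense sequence that contain it. Decoding
    picks, for each j, the least centre whose ball is marked; these centres converge to the
    point. *)
Lemma polish_ereal_retract (R : realType) (X : ptopologicalType) :
  polish R X -> ereal_retract R (borel X).
Proof.
move=> [sepX [dist [dist_metric dist_top dist_complete]]].
have [u u_dense] := dense_sequence dist_metric dist_top sepX.
pose ball (p : nat * nat) : set X := [set x | (dist (u p.1) x < 2%:R ^- p.2)%R].
pose B k : set (borel X) := if unpickle k is Some p then ball p else set0.
have mB k : measurable (B k).
  rewrite /B; case: unpickle => // p; apply: sub_sigma_algebra.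
  exact: (open_metric_ball dist_metric dist_top).
have [phi [mphi phiE]] := ternary_code R mB.
have phi_ball (i j : nat) x :
    ternary_digit (pickle (i, j)) (phi x) <-> (dist (u i) x < 2%:R ^- j)%R.
  by apply: (iff_trans (phiE _ _)); rewrite /B pickleK.
have exN : forall j : nat, exists N : \bar R -> nat,
    (forall i, measurable [set s | N s = i]) /\
    forall s, (exists i : nat, ternary_digit (pickle (i, j)) s) ->
      ternary_digit (pickle (N s, j)) s.
  by move=> j; apply: measurable_least_index => i; exact: measurable_ternary_digit.
have [N NP] := choice exN.
have [theta [mtheta thetaE]] := fast_limit dist_metric dist_top dist_complete u
  (fun j => (NP j).1).
exists phi, theta; split => // x; apply: thetaE => j.
apply/phi_ball/(NP j).2.
have [|i ix] := u_dense x (2%:R ^- j)%R; first by rewrite invr_gt0 exprn_gt0.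
by exists i; exact/phi_ball.
Qed.

(** * Borel sets of a product of Polish spaces *)

(** By separability, an open set is the union of the countably many boxes of balls it contains, with
    dense centres and radii 1 / (k + 1). *)
Lemma polish_open_prod (R : realType) (X Y : ptopologicalType) :
  polish R X -> polish R Y ->
  forall W : set (X * Y), open W ->
    measurable (W : set (borel X * borel Y)%type).
Proof.
move=> [sepX [dX [mX tX cX]]] [sepY [dY [mY tY cY]]] W oW.
have [u u_dense] := dense_sequence mX tX sepX.
have [v v_dense] := dense_sequence mY tY sepY.
pose e (k : nat) : R := k.+1%:R^-1%R.
have e_gt0 k : (0 < e k)%R by rewrite invr_gt0.
pose bX i k : set X := [set x | (dX (u i) x < e k)%R].
pose bY i k : set Y := [set y | (dY (v i) y < e k)%R].
have e_lt (r : R) : (0 < r)%R -> exists k, (e k < r)%R.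
  move=> r0; exists (Num.bound r^-1); rewrite /e -[ltRHS]invrK.
  rewrite ltf_pV2 ?posrE ?invr_gt0//.
  by apply: lt_le_trans (archi_boundP _) _; rewrite ?invr_ge0 ?(ltW r0)// ler_nat.
have small (T : ptopologicalType) (dT : T -> T -> R) (w : nat -> T) :
    is_metric dT -> metric_induces_topology dT ->
    (forall x (r : R), (0 < r)%R -> exists i, (dT (w i) x < r)%R) ->
    forall x (V : set T), nbhs x V -> exists i k, (dT (w i) x < e k)%R /\
      [set y | (dT (w i) y < e k)%R] `<=` V.
  move=> [_ _ dC dtri] tT w_dense x V /tT[r r0 rV].
  have [k kr] : exists k, (e k < r / 2)%R by apply: e_lt; rewrite divr_gt0.
  have [i ix] := w_dense x (e k) (e_gt0 k).
  exists i, k; split => // y iy; apply: rV => /=.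
  apply: le_lt_trans (dtri x (w i) y) _; rewrite dC; move: ix iy => /=; lra.
pose box (p : (nat * nat) * (nat * nat)) : set (borel X * borel Y) :=
  bX p.1.1 p.1.2 `*` bY p.2.1 p.2.2.
rewrite (_ : W = \bigcup_p (if `[< box p `<=` W >] then box p else set0)).
  apply: countable_bigcupT_measurable => // p; case: ifP => // _.
  by apply: measurableX; apply: sub_sigma_algebra; exact: open_metric_ball.
apply/seteqP; split => [[x y] Wxy|z [p _]]; last first.
  by case: ifPn => // /asboolP; apply.
have : nbhs (x, y) W by exact: open_nbhs_nbhs.
move=> [[V V'] /= [xV yV'] VV'W].
have [i [k [ix iV]]] := small _ _ _ mX tX u_dense _ _ xV.
have [j [l [jy jV']]] := small _ _ _ mY tY v_dense _ _ yV'.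
exists ((i, k), (j, l)) => //; rewrite ifT//; apply/asboolP => -[x' y'] [ix' jy'].
by apply: VV'W; split; [exact: iV|exact: jV'].
Qed.

Lemma polish_borel_prod (R : realType) (X Y : ptopologicalType) :
  polish R X -> polish R Y ->
  forall W : set (X * Y), measurable (W : set (borel (X * Y)%type)) ->
    measurable (W : set (borel X * borel Y)%type).
Proof.
move=> pX pY; apply: smallest_sub; first exact: sigma_algebra_measurable.
exact: (polish_open_prod pX pY).
Qed.

(** Continuity of the projections puts the product sigma-algebra inside the Borel one, so plans can
    be pushed to [borel X * borel Y], where the chains are built. *)
Lemma borel_prod_id_measurable (X Y : ptopologicalType) :
  measurable_fun setT
    (fun z : borel (X * Y)%type => (z.1 : borel X, z.2 : borel Y)).
Proof.
apply: measurable_fun_pair.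
- apply: (@measurability _ _ (borel (X * Y)%type) (borel X) setT _ (@open X) erefl).
  move=> _ [V oV <-]; rewrite setTI; apply: sub_sigma_algebra.
  have /continuousP : continuous (@fst X Y) by move=> [x y]; exact: cvg_fst.
  exact.
- apply: (@measurability _ _ (borel (X * Y)%type) (borel Y) setT _ (@open Y) erefl).
  move=> _ [V oV <-]; rewrite setTI; apply: sub_sigma_algebra.
  have /continuousP : continuous (@snd X Y) by move=> [x y]; exact: cvg_snd.
  exact.
Qed.

(** * Optimality of cyclically monotone plans *)

Lemma transport_plan_coupling (R : realType) (X Y : ptopologicalType)
    (mu : probability (borel X) R) (nu : probability (borel Y) R)
    (rho : probability (borel (X * Y)%type) R) :
  transport_plans mu nu rho ->
  exists2 rho' : probability (borel X * borel Y)%type R, coupling mu nu rho' &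
    has_law rho (fun z => (z.1 : borel X, z.2 : borel Y)) rho'.
Proof.
move=> [rho_mu rho_nu].
have [rho' rho'E] := has_law_ex rho (@borel_prod_id_measurable X Y).
exists rho' => //; split; split => // A mA.
- rewrite -rho_mu//; case: rho'E => _ <-//.
  by rewrite -[_ @^-1` _]setTI; exact: measurable_fst.
- rewrite -rho_nu//; case: rho'E => _ <-//.
  by rewrite -[_ @^-1` _]setTI; exact: measurable_snd.
Qed.

Theorem theorem2 (R : realType) (X Y : ptopologicalType)
    (X_polish : polish R X) (X_lc : locally_compact [set: X])
    (Y_polish : polish R Y) (Y_lc : locally_compact [set: Y])
    (mu : probability (borel X) R) (nu : probability (borel Y) R)
    (c : X * Y -> \bar R)
    (c_ge0 : forall z, 0 <= c z)
    (c_meas : measurable_fun [set: borel (X * Y)%type] c)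
    (c_fin : {ae (mu \x nu), forall z, c z < +oo})
    (pi : probability (borel (X * Y)%type) R)
    (pi_plan : transport_plans mu nu pi)
    (pi_cm : cyclically_monotone_plan c pi)
    (pi_fin : transport_cost c pi < +oo) :
  optimal_plan c mu nu pi.
Proof.
split=> // gamma gamma_plan.
have [pi' pi'_cpl pi'E] := transport_plan_coupling pi_plan.
have [gamma' gamma'_cpl gamma'E] := transport_plan_coupling gamma_plan.
have mc : measurable_fun setT (c : borel X * borel Y -> \bar R).
  move=> _ A mA; rewrite setTI; apply: (polish_borel_prod X_polish Y_polish).
  by rewrite -[_ @^-1` _]setTI; exact: c_meas.
(* Since [c] is measurable for the product sigma-algebra too, pushing a plan there preserves its
   cost. *)
have costE (rho : probability (borel (X * Y)%type) R)
    (rho' : probability (borel X * borel Y)%type R) :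
    has_law rho (fun z => (z.1 : borel X, z.2 : borel Y)) rho' ->
    transport_cost c rho = \int[rho']_z c z.
  move=> rhoE; rewrite -(has_law_integral rhoE mc c_ge0).
  by apply: eq_integral => -[].
rewrite (costE _ _ pi'E) (costE _ _ gamma'E).
have [Gamma [mGamma cm piGamma]] := pi_cm.
have mGamma' := polish_borel_prod X_polish Y_polish mGamma.
apply: (cyclically_monotone_cost_le (polish_ereal_retract X_polish)
  (polish_ereal_retract Y_polish) pi'_cpl gamma'_cpl c_ge0 mc c_fin mGamma' cm).
case: pi'E => _ <-//; rewrite -piGamma; congr (pi _).
by apply/seteqP; split => -[].
Qed.
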